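(* Let $n=6k+2$ with $k\ge 6$, and let $P(n,3)$ be the generalized Petersen graph with vertex set $\{u_1,\dots,u_n,v_1,\dots,v_n\}$ and edge set $\{u_iu_{i+1},\,u_iv_i,\,v_iv_{i+3}:1\le i\le n\}$ (subscripts modulo $n$). Then $\dim(P(n,3))\ge 4$.
   Context: For a connected graph $G$, an ordered set $W=\{w_1,\dots,w_m\}\subseteq V(G)$ is a resolving set if the vectors $r(z|W)=(d(z,w_1),\dots,d(z,w_m))$ of shortest-path distances are pairwise distinct over all $z\in V(G)$. The metric dimension $\dim(G)$ is the minimum cardinality of a resolving set of $G$. *)

(* Defs.v *)
From mathcomp Require Import all_boot.

Set Implicit Arguments.
Unset Strict Implicit.
Unset Printing Implicit Defensive.

Section MetricDimension.
Variables (T : finType) (e : rel T).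

Definition walk (x y : T) (l : nat) : bool :=
  [exists p : l.-tuple T, path e x p && (last x p == y)].

(* The least length of a walk from x to y. A shortest walk has length less than
   #|T|, so searching lengths below #|T| suffices; the value is #|T| exactly
   when x and y lie in different components. *)
Definition dist (x y : T) : nat := find (walk x y) (iota 0 #|T|).

(* r(z|W); an ordered set W is a duplicate-free sequence. *)
Definition metric_code (W : seq T) (z : T) : seq nat := [seq dist z w | w <- W].

Definition resolving (W : seq T) : bool := uniq W && injectiveb (metric_code W).

Lemma dist_eq0 x y : (dist x y == 0) = (x == y).
Proof.
have : 0 < #|T| by apply/card_gt0P; exists x.
rewrite /dist; case: #|T| => // m _ /=.
suff -> : walk x y 0 = (x == y) by case: (x == y).
apply/existsP/idP => [[p]|xy]; first by rewrite tuple0.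
by exists [tuple].
Qed.

Lemma resolving_enum : resolving (enum T).
Proof.
rewrite /resolving enum_uniq; apply/injectiveP => x y /eq_in_map /(_ x).
rewrite mem_enum => /(_ isT) xy; apply/eqP; rewrite eq_sym -dist_eq0 -xy.
by rewrite dist_eq0.
Qed.

Lemma ex_resolving : exists m, [exists W : m.-tuple T, resolving W].
Proof.
by exists (size (enum T)); apply/existsP; exists (in_tuple (enum T));
  exact: resolving_enum.
Qed.

Definition metric_dim : nat := ex_minn ex_resolving.

End MetricDimension.

(* The vertices of P(n, m): inl i is u_i and inr i is v_i, with the subscripts
   modulo n represented by 0, ..., n - 1. *)
Definition gpetersen_arc (n m : nat) (x y : 'I_n + 'I_n) : bool :=
  match x, y with
  | inl i, inl j => j == (i + 1) %% n :> nat
  | inl i, inr j => j == i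
  | inr i, inr j => j == (i + m) %% n :> nat
  | inr _, inl _ => false
  end.

Definition gpetersen (n m : nat) : rel ('I_n + 'I_n) :=
  fun x y => gpetersen_arc m x y || gpetersen_arc m y x.

(* Main.v *)
(* For every triple W of vertices there is an outer pair u_y, u_(y+2) that no
   element of W resolves. The distances are explicit: on the infinite
   cover (indices in Z) the distance at offset r is given by r / 3 and r mod 3,
   and on the cycle one takes the better of the two directions.
   The existence of the pair is proved by induction on k. The residues of W
   modulo n/2 leave a gap of length at least 10. Deleting three positions
   inside this gap and three at the antipode maps P(n, 3) to P(n - 6, 3).
   Undoing this, a distance grows by 1 if the cut separates the two vertices and
   is unchanged otherwise, so a pair on one side of the cut that W does not
   resolve stays unresolved. The cases k = 6, 7, 8 are decided by computation. *)

Require Import Defs.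
From mathcomp Require Import all_boot.
From mathcomp Require Import zify.

Set Implicit Arguments.
Unset Strict Implicit.
Unset Printing Implicit Defensive.

(** * Recognizing a distance function by local conditions *)

Section DistCharacterization.
Variables (T : finType) (e : rel T) (x : T) (f : T -> nat).
Hypotheses (fx : f x = 0) (f_edge : forall y z, e y z -> f z <= (f y).+1).
Hypothesis f_desc : forall y, y != x -> exists2 z, e z y & f z < f y.

Lemma walk_lower_bound y l : walk e x y l -> f y <= l.
Proof.
case/existsP => -[p /= /eqP <-] /andP[+ /eqP <-].
elim/last_ind: p => [|p z IHp]; first by rewrite /= fx.
rewrite rcons_path last_rcons size_rcons => /andP[/IHp fp /f_edge fz].
exact: leq_trans fz _.
Qed.

Lemma walk_of_desc y : walk e x y (f y).
Proof.
move: {2}(f y) (erefl (f y)) => m; elim: m y => [|m IHm] y fy.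
  have [->|/f_desc[z _]] := eqVneq y x; last by rewrite fy.
  by rewrite fx; apply/existsP; exists [tuple] => /=.
have [yx|/f_desc[z ezy fzy]] := eqVneq y x; first by move: fy; rewrite yx fx.
have fz : f z = m by have := f_edge ezy; lia.
have := IHm z fz; rewrite fz fy => /existsP[p /andP[xp /eqP pz]].
apply/existsP; exists [tuple of rcons p y].
by rewrite rcons_path last_rcons xp pz ezy /=.
Qed.

(** [f_edge] bounds every walk length from below, and following [f_desc] back to [x] gives a walk of
    length [f y]. The bound by [#|T|] puts [f y] in the range that [dist] searches. *)
Lemma dist_char y : f y < #|T| -> dist e x y = f y.
Proof.
move=> fyT; have hasw : has (walk e x y) (iota 0 #|T|).
  by apply/hasP; exists (f y); [rewrite mem_iota | exact: walk_of_desc].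
have dT : dist e x y < #|T| by rewrite -[X in _ < X](size_iota 0) -has_find.
apply/eqP; rewrite eqn_leq; apply/andP; split; last first.
  by apply: walk_lower_bound; have := nth_find 0 hasw; rewrite nth_iota.
rewrite leqNgt; apply/negP => lt_f.
by have := before_find 0 lt_f; rewrite nth_iota // walk_of_desc.
Qed.

End DistCharacterization.

(** * Distance formulas on the infinite cover and on the cycle *)

(* Types of vertices are encoded by booleans: true for u, false for v. *)
Definition line_dist (t t' : bool) (r : nat) : nat :=
  if t (+) t' then r %/ 3 + r %% 3 + 1
  else if t then minn r (r %/ 3 + r %% 3 + 2)
  else r %/ 3 + (if r %% 3 == 0 then 0 else r %% 3 + 2).

Definition cycle_dist (n : nat) (t t' : bool) (r : nat) : nat :=
  minn (line_dist t t' r) (line_dist t t' (n - r)).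

Definition offset (n x y : nat) : nat := if x <= y then y - x else y + n - x.

Definition shift (n s x : nat) : nat := if x + s < n then x + s else x + s - n.

Definition vdist (n : nat) (w z : bool * nat) : nat :=
  cycle_dist n w.1 z.1 (offset n w.2 z.2).

Lemma line_dist_step t t' r :
  line_dist t t' (r + (if t' then 1 else 3)) <= (line_dist t t' r).+1.
Proof. rewrite /line_dist; case: t t' => -[] /=; do ?case: ifP; lia. Qed.

Lemma line_dist_back t t' r :
  line_dist t t' r <= (line_dist t t' (r + (if t' then 1 else 3))).+1.
Proof. rewrite /line_dist; case: t t' => -[] /=; do ?case: ifP; lia. Qed.

Lemma line_dist_spoke t t' r : line_dist t t' r <= (line_dist t (~~ t') r).+1.
Proof. rewrite /line_dist; case: t t' => -[] /=; do ?case: ifP; lia. Qed.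

(** Steps away from offset 0 never help: at residue 2, overshooting by an inner edge and returning
    by one outer edge costs as much as two outer edges. *)
Lemma line_dist_desc t t' r (s := if t' then 1 else 3) :
  (t != t') || (0 < r) ->
  line_dist t (~~ t') r < line_dist t t' r \/
  s <= r /\ line_dist t t' (r - s) < line_dist t t' r.
Proof.
rewrite {}/s /line_dist; case: t t' => -[] /= r0; do ?case: ifP; lia.
Qed.

Lemma cycle_dist_sym n t t' r : r <= n ->
  cycle_dist n t t' (n - r) = cycle_dist n t t' r.
Proof. by move=> rn; rewrite /cycle_dist subKn // minnC. Qed.

Lemma cycle_dist_shift n t t' r (s := if t' then 1 else 3) : 14 <= n -> r < n ->
  cycle_dist n t t' (shift n s r) <= (cycle_dist n t t' r).+1 /\
  cycle_dist n t t' r <= (cycle_dist n t t' (shift n s r)).+1.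
Proof.
move=> n14 rn; rewrite /shift; case: ltnP => rs; rewrite /cycle_dist.
  have := line_dist_step t t' r; have := line_dist_back t t' r.
  (* The complementary arc shrinks by [s] while the first one grows, so the two bounds swap
     roles. *)
  have := line_dist_step t t' (n - (r + s)).
  have := line_dist_back t t' (n - (r + s)).
  rewrite -/s (_ : n - (r + s) + s = n - r); last by move: (s) rs; lia.
  by move: (line_dist _ _ _) (line_dist _ _ _); lia.
(* The step reaches or passes offset 0, so both offsets are within 3 of it on the cycle. *)
have : s <= 3 by rewrite /s; case: (t').
rewrite /s /line_dist in rs *; case: t t' rs {s} => -[] /= rs _; do ?case: ifP; lia.
Qed.

Lemma cycle_dist_spoke n t t' r :
  cycle_dist n t t' r <= (cycle_dist n t (~~ t') r).+1.
Proof.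
by rewrite /cycle_dist; have := line_dist_spoke t t' r;
  have := line_dist_spoke t t' (n - r); lia.
Qed.

(** Descend along an arc that attains the minimum: shortening [r] is a step backward, a shift by
    [n - s], and shortening [n - r] is a step forward. *)
Lemma cycle_dist_desc n t t' r (s := if t' then 1 else 3) :
  3 <= n -> r < n -> (t != t') || (0 < r) ->
  [\/ cycle_dist n t (~~ t') r < cycle_dist n t t' r,
      cycle_dist n t t' (shift n s r) < cycle_dist n t t' r
    | cycle_dist n t t' (shift n (n - s) r) < cycle_dist n t t' r].
Proof.
move=> n3 rn tr; have s3 : 0 < s <= 3 by rewrite /s; case: (t').
have [le|lt] := leqP (line_dist t t' r) (line_dist t t' (n - r)).
  case: (line_dist_desc tr) => [h|]; rewrite -/s.
    by apply: Or31; rewrite /cycle_dist; lia.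
  move=> [sr h]; apply: Or33; rewrite /shift ifF; last by lia.
  by rewrite (_ : r + (n - s) - n = r - s) /cycle_dist; lia.
have tr' : (t != t') || (0 < n - r) by rewrite subn_gt0 rn orbT.
case: (line_dist_desc tr') => [h|]; rewrite -/s.
  by apply: Or31; rewrite /cycle_dist; lia.
move=> [sr h]; apply: Or32; rewrite /shift; have [rs|rs] := ltnP (r + s) n.
  by rewrite /cycle_dist subnDA; move: h lt; lia.
rewrite (_ : r + s - n = n - r - s); last by lia.
by rewrite /cycle_dist; lia.
Qed.

Lemma cycle_dist_bound n t t' r : 14 <= n -> r < n -> cycle_dist n t t' r < n + n.
Proof.
by move=> n14 rn; rewrite /cycle_dist /line_dist; case: t t' => -[] /=;
  do ?case: ifP; lia.
Qed.

Lemma shift_lt n s x : 0 < n -> s <= n -> x < n -> shift n s x < n.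
Proof. by rewrite /shift; case: ifP; lia. Qed.

Lemma offset_lt n x y : x < n -> y < n -> offset n x y < n.
Proof. by rewrite /offset; case: ifP; lia. Qed.

Lemma offset_shift n s x y : s <= n -> x < n -> y < n ->
  offset n x (shift n s y) = shift n s (offset n x y).
Proof. by rewrite /offset /shift; do ?case: ifP; lia. Qed.

Lemma shiftK n s x : s <= n -> x < n -> shift n s (shift n (n - s) x) = x.
Proof. by rewrite /shift; do ?case: ifP; lia. Qed.

Lemma shift_modn n s x : s <= n -> x < n -> (x + s) %% n = shift n s x.
Proof.
move=> sn xn; rewrite /shift; case: ltnP => h; first by rewrite modn_small.
by rewrite -{1}(subnK h) modnDr modn_small //; lia.
Qed.

(** * Distances in P(n, 3) *)

Definition coords n (z : 'I_n + 'I_n) : bool * nat :=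
  match z with inl i => (true, nat_of_ord i) | inr i => (false, nat_of_ord i) end.

Definition vertex n (w : bool * nat) (wn : w.2 < n) : 'I_n + 'I_n :=
  if w.1 then inl (Ordinal wn) else inr (Ordinal wn).

Lemma vertexK n w (wn : w.2 < n) : coords (vertex wn) = w.
Proof. by case: w wn => -[] x. Qed.

Lemma coords_inj n : injective (@coords n).
Proof. by move=> [i|i] [j|j] //= [] /ord_inj ->. Qed.

Lemma coords_lt n (z : 'I_n + 'I_n) : (coords z).2 < n.
Proof. by case: z => i /=. Qed.

Lemma gpetersen_arcE n (y z : 'I_n + 'I_n) : 3 <= n ->
  gpetersen_arc 3 y z =
  ((coords z == ((coords y).1, shift n (if (coords y).1 then 1 else 3) (coords y).2))
   || [&& (coords y).1, ~~ (coords z).1 & (coords z).2 == (coords y).2]).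
Proof.
move=> n3; case: y z => [i|i] [j|j] //=;
  rewrite ?shift_modn ?ltn_ord ?xpair_eqE ?orbF //.
by rewrite (leq_trans _ n3).
Qed.

(** [vdist] from [x] satisfies the conditions of [dist_char]: arcs are spokes or shifts of the
    offset, and [cycle_dist] was bounded along both. *)
Lemma gpetersen_dist n (x y : 'I_n + 'I_n) : 14 <= n ->
  dist (@gpetersen n 3) x y = vdist n (coords x) (coords y).
Proof.
move=> n14; have n3 : 3 <= n by lia.
have n0 : 0 < n by lia.
have sn (t : bool) : (if t then 1 else 3) <= n by case: t; lia.
pose f (y : 'I_n + 'I_n) := vdist n (coords x) (coords y).
have arc_f (y1 z : 'I_n + 'I_n) : gpetersen_arc 3 y1 z ->
    f z <= (f y1).+1 /\ f y1 <= (f z).+1.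
  rewrite gpetersen_arcE // /f /vdist => /orP[/eqP->|/and3P[y1T zF /eqP->]] /=.
    rewrite offset_shift ?coords_lt //.
    by apply: cycle_dist_shift => //; rewrite offset_lt ?coords_lt.
  have -> : (coords z).1 = ~~ (coords y1).1 by rewrite y1T; apply/negbTE.
  split; last exact: cycle_dist_spoke.
  by have := cycle_dist_spoke n (coords x).1 (~~ (coords y1).1)
    (offset n (coords x).2 (coords y1).2); rewrite negbK.
apply: (dist_char (f := f)).
- rewrite /f /vdist /offset leqnn subnn /cycle_dist /line_dist addbb.
  by case: (coords x).1 => /=; lia.
- by move=> y1 z /orP[/arc_f[]|/arc_f[]].
- move=> z zx; case E : (coords z) => [t r].
  have rn : r < n by have := coords_lt z; rewrite E.
  have r0 : ((coords x).1 != t) || (0 < offset n (coords x).2 r).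
    apply/norP => -[/negPn/eqP t_x]; rewrite -leqNgt => o0.
    case/eqP: zx; apply: coords_inj; rewrite E [RHS]surjective_pairing t_x.
    by congr pair; move: o0 (coords_lt x); rewrite /offset; case: ifP; lia.
  have on := offset_lt (coords_lt x) rn.
  (* The witnesses are the neighbours of [z] across the spoke, one step forward and one step
     backward. *)
  case: (cycle_dist_desc n3 on r0); rewrite /f /vdist E /= => h.
  + exists (@vertex n (~~ t, r) rn); last by rewrite vertexK.
    rewrite /gpetersen !gpetersen_arcE // vertexK E /= eqxx andbT.
    by case: (t) => /=; rewrite ?orbT.
  + have rn' := shift_lt n0 (sn t) rn.
    exists (@vertex n (t, shift n (if t then 1 else 3) r) rn').
      by rewrite /gpetersen !gpetersen_arcE // vertexK E /= eqxx !orbT.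
    by rewrite vertexK /= offset_shift ?coords_lt.
  + have rn' := shift_lt n0 (leq_subr (if t then 1 else 3) n) rn.
    exists (@vertex n (t, shift n (n - (if t then 1 else 3)) r) rn').
      by rewrite /gpetersen !gpetersen_arcE // vertexK E /= shiftK ?eqxx.
    by rewrite vertexK /= offset_shift ?coords_lt ?leq_subr.
- rewrite card_sum card_ord; apply: cycle_dist_bound => //.
  by rewrite offset_lt ?coords_lt.
Qed.

(** Swapping the endpoints turns a nonzero offset [r] into [n - r], which exchanges the two
    directions. [metric_code] measures towards the landmark, [collision] from it. *)
Lemma vdist_sym n w z : w.2 < n -> z.2 < n -> vdist n w z = vdist n z w.
Proof.
case: w z => [t x] [t' y] /= xn yn; rewrite /vdist /=.
have sym r : line_dist t t' r = line_dist t' t r.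
  by rewrite /line_dist addbC; case: t t' => -[].
rewrite /cycle_dist !sym /offset; case: ifP => xy; case: ifP => yx.
- by rewrite (_ : y - x = x - y); lia.
- by rewrite minnC (_ : n - (y - x) = x + n - y) 1?(_ : n - (x + n - y) = y - x); lia.
- by rewrite minnC (_ : n - (y + n - x) = x - y) 1?(_ : n - (x - y) = y + n - x); lia.
- by lia.
Qed.

(** * Unresolved pairs and rotation *)

Definition collision (n : nat) (W : seq (bool * nat)) : Prop :=
  exists2 y, y < n &
    {in W, forall w, vdist n w (true, y) = vdist n w (true, shift n 2 y)}.

Lemma offset_shift2 n c x y : c <= n -> x < n -> y < n ->
  offset n (shift n c x) (shift n c y) = offset n x y.
Proof. by rewrite /offset /shift; do ?case: ifP; lia. Qed.

Lemma shiftA n c s x : c <= n -> s <= n -> x < n ->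
  shift n c (shift n s x) = shift n s (shift n c x).
Proof. by rewrite /shift; do ?case: ifP; lia. Qed.

Lemma collision_rotate n c (W : seq (bool * nat)) : c <= n -> 2 <= n ->
  {in W, forall w, w.2 < n} ->
  collision n [seq (w.1, shift n c w.2) | w <- W] -> collision n W.
Proof.
move=> cn n2 Wn [y yn coll].
have n0 : 0 < n by lia.
have y'n := shift_lt n0 (leq_subr c n) yn.
exists (shift n (n - c) y) => // w wW.
have := coll _ (map_f _ wW); rewrite /vdist /=.
rewrite -{1 2}(shiftK cn yn) -(shiftA cn n2 y'n).
by rewrite !offset_shift2 ?Wn ?shift_lt ?leq_subr.
Qed.

(** * Lengthening the cycle by six *)

(* Opens room for three positions at c and for three at its antipode h + c. *)
Definition insert3 (h c x : nat) : nat :=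
  if x < c then x else if x < h + c then x + 3 else x + 6.

(** From offset 3 on, the purely outer route never beats the one through inner edges, so three more
    positions on each arc cost exactly one inner edge. *)
Lemma cycle_dist_far n t t' r : 3 <= r -> r + 3 <= n ->
  cycle_dist (n + 6) t t' (r + 3) = (cycle_dist n t t' r).+1.
Proof.
move=> r3 rn; rewrite /cycle_dist (_ : n + 6 - (r + 3) = n - r + 3); last by lia.
have step u : 3 <= u -> line_dist t t' (u + 3) = (line_dist t t' u).+1.
  by rewrite /line_dist; case: t t' => -[] /=; do ?case: ifP; lia.
by rewrite !step ?minnSS //; lia.
Qed.

(** [line_dist] is not monotone: between inner vertices offset 3q+2 costs q+4, but 3q+6 costs q+2
    and 3q+9 costs q+3. Here the two arcs differ by an even number that is at least 6, and then the
    shorter arc is at least as good. *)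
Lemma cycle_dist_near h t t' r : r + 3 <= h ->
  cycle_dist (h.*2) t t' r = line_dist t t' r.
Proof.
move=> rh; rewrite /cycle_dist; apply/minn_idPl.
by rewrite /line_dist; case: t t' => -[] /=; do ?case: ifP; lia.
Qed.

(** If the cuts separate the vertices, each arc crosses one cut and gains 3, as in [cycle_dist_far].
    Otherwise one arc crosses both cuts and gains 6, while the other is unchanged and decides the
    distance. The bounds on [c] keep [x] at least 3 away from the other side. *)
Lemma vdist_insert3 h c L t x t' z :
  L + 3 <= c -> c + 2 <= h -> (x <= L) || (h <= x <= h + L) -> z < h.*2 ->
  vdist (h.*2 + 6) (t, insert3 h c x) (t', insert3 h c z) =
  vdist h.*2 (t, x) (t', z) + ((c <= x < h + c) (+) (c <= z < h + c)).
Proof.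
move=> Lc ch xL zh; rewrite /vdist /=.
have o := @offset_lt h.*2 x z; have xh : x < h.*2 by lia.
have eq_h : h.*2 + 6 = (h + 3).*2 by lia.
have [sep|unsep] := boolP ((c <= x < h + c) (+) (c <= z < h + c)).
  have [o1 o3 ->] : [/\ 3 <= offset h.*2 x z, offset h.*2 x z + 3 <= h.*2 &
    offset (h.*2 + 6) (insert3 h c x) (insert3 h c z) = offset h.*2 x z + 3].
    by split; rewrite /offset /insert3; do ?case: ifP; lia.
  by rewrite cycle_dist_far // addn1.
rewrite addn0.
have [[or ->]|[or ->]] : offset h.*2 x z + 3 <= h /\
     offset (h.*2 + 6) (insert3 h c x) (insert3 h c z) = offset h.*2 x z \/
   h + 3 <= offset h.*2 x z /\
     offset (h.*2 + 6) (insert3 h c x) (insert3 h c z) = offset h.*2 x z + 6.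
- by move: unsep; rewrite /offset /insert3; do ?case: ifP; lia.
- by rewrite eq_h !cycle_dist_near //; lia.
(* The unchanged short arc is now the complementary one. *)
- have {}o := o xh zh; rewrite -[LHS]cycle_dist_sym; last by lia.
  rewrite -[RHS]cycle_dist_sym; last by lia.
  by rewrite subnDr eq_h !cycle_dist_near //; lia.
Qed.

(** The cut may depend on [y]: it is placed in the gap so that it does not split the pair, and then
    both distances from a landmark change equally. [L + 7 <= h] leaves room for the candidates
    [L + 3] and [L + 5]. *)
Lemma collision_insert3 h L (W : seq (bool * nat)) : L + 7 <= h ->
  {in W, forall w, (w.2 <= L) || (h + 3 <= w.2 <= h + 3 + L)} ->
  collision h.*2 [seq (w.1, if w.2 <= L then w.2 else w.2 - 3) | w <- W] ->
  collision (h.*2 + 6) W.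
Proof.
move=> Lh WL [y yn coll].
have [c [Lc ch yc]] : exists c, [/\ L + 3 <= c, c + 2 <= h &
   (c <= y < h + c) = (c <= shift h.*2 2 y < h + c)].
  pose same c := (c <= y < h + c) = (c <= shift h.*2 2 y < h + c).
  (* The two cuts are 2 apart, so the pair (y, y + 2) straddles at most one. *)
  have [|] : same (L + 3) \/ same (L + 5).
    by rewrite /same /shift; case: ifP; lia.
  - by exists (L + 3); split => //; lia.
  - by exists (L + 5); split => //; lia.
have shift_y : insert3 h c (shift h.*2 2 y) = shift (h.*2 + 6) 2 (insert3 h c y).
  by move: yc; rewrite /shift /insert3; do ?case: ifP; lia.
exists (insert3 h c y).
  by rewrite /insert3; do ?case: ifP; lia.
move=> [tw x] wW; have /= xL := WL _ wW.
have /= := coll _ (map_f _ wW); set x' := (if _ then _ else _) => eq_d.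
(* Every landmark lies before the antipodal cut, so undoing the deletion adds 0 or 3, never 6. *)
have ->: x = insert3 h c x' by rewrite /x' /insert3; do ?case: ifP; lia.
have x'L : (x' <= L) || (h <= x' <= h + L) by rewrite /x'; case: ifP; lia.
have y'n : shift h.*2 2 y < h.*2 by apply: shift_lt => //; lia.
by rewrite -shift_y !(vdist_insert3 _ _ Lc ch x'L) // eq_d yc.
Qed.

(** * Induction step *)

Definition all_collide (n : nat) : Prop := forall W : seq (bool * nat),
  size W = 3 -> {in W, forall w, w.2 < n} -> collision n W.

(** The three gaps between cyclically consecutive points add up to [H], which exceeds 3 * 9, so one
    gap is at least 10; [o] is the point that ends it. *)
Lemma circular_gap H (P : seq nat) :
  28 <= H -> size P = 3 -> {in P, forall p, p < H} ->
  exists2 o, o < H & {in P, forall p, offset H o p + 10 <= H}.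
Proof.
case: P => [|p [|q [|r []]]] //= H28 _ PH.
have [pH qH rH] : [/\ p < H, q < H & r < H] by split; apply: PH; rewrite !inE eqxx ?orbT.
have off x : offset H x x + 10 <= H by rewrite /offset leqnn; lia.
suff : [\/ offset H p q + 10 <= H /\ offset H p r + 10 <= H,
           offset H q p + 10 <= H /\ offset H q r + 10 <= H
         | offset H r p + 10 <= H /\ offset H r q + 10 <= H].
  by case=> [] [h1 h2]; [exists p | exists q | exists r] => // x;
    rewrite !inE => /or3P[] /eqP->.
have [h|[h|h]] : offset H p q + 10 <= H /\ offset H p r + 10 <= H \/
  (offset H q p + 10 <= H /\ offset H q r + 10 <= H \/
   offset H r p + 10 <= H /\ offset H r q + 10 <= H).
  by rewrite /offset; do ?case: ifP; lia.
- exact: Or31.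
- exact: Or32.
- exact: Or33.
Qed.

Lemma all_collide_insert3 h : 25 <= h -> all_collide h.*2 -> all_collide (h.*2 + 6).
Proof.
move=> h25 IH W sW Wn; set H := h + 3.
(* Half the length is [H]. Reduction modulo [H] identifies antipodes, so a gap among the residues is
   a pair of antipodal gaps on the cycle. *)
pose red x := if x < H then x else x - H.
have [|||o oH gap] := @circular_gap H [seq red w.2 | w <- W]; first by rewrite /H; lia.
- by rewrite size_map.
- by move=> _ /mapP[[t x] /Wn /= xn ->]; rewrite /red /H; case: ifP; lia.
(* Rotation by [H - o] sends [o] to [H] and its antipode to 0; the gap of 10 then leaves offsets up
   to [H - 10], which is [h - 7]. *)
have cH : H - o <= h.*2 + 6 by rewrite /H; lia.
have cW : {in W, forall w, let x := shift (h.*2 + 6) (H - o) w.2 in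
    (x <= h - 7) || (H <= x <= H + (h - 7))}.
  move=> [t x] xW; have := gap _ (map_f _ xW); have := Wn _ xW; move: oH.
  by rewrite /= /offset /red /shift /H; do ?case: ifP; lia.
apply: (collision_rotate cH) => //; first by lia.
apply: (collision_insert3 (L := h - 7)); first by lia.
  by move=> w /mapP[v /cW vL ->].
apply: IH; first by rewrite !size_map.
move=> w /mapP[v /mapP[u /cW uL ->] ->] /=; move: uL; rewrite /H /=.
by case: ifP; lia.
Qed.

(** * Base cases by computation *)

Definition collide_test (n : nat) (w : bool * nat) (y : nat) : bool :=
  vdist n w (true, y) == vdist n w (true, shift n 2 y).

(* Whether w separates the pair at y depends only on the offset from w to y;
   the table avoids recomputing distances in all_collide_check. *)
Definition collide_table (n : nat) (t : bool) : seq bool :=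
  [seq collide_test n (t, 0) r | r <- iota 0 n].

Lemma nth_collide_table n w y : 2 <= n -> w.2 < n -> y < n ->
  nth false (collide_table n w.1) (offset n w.2 y) = collide_test n w y.
Proof.
move=> n2 wn yn; have on := offset_lt wn yn; have n0 : 0 < n by lia.
rewrite (nth_map 0) ?size_iota // nth_iota // /collide_test /vdist /=.
rewrite !offset_shift //.
by rewrite (_ : offset n 0 (0 + offset n w.2 y) = offset n w.2 y) // /offset subn0.
Qed.

(** By rotation the first landmark sits at index 0, so only its type varies. Filtering the candidate
    pairs landmark by landmark shares work between triples. *)
Definition all_collide_check (n : nat) : bool :=
  let V := [seq (t, x) | t <- [:: true; false], x <- iota 0 n] in
  let tu := collide_table n true in
  let tv := collide_table n false in
  let col (w : bool * nat) y := nth false (if w.1 then tu else tv) (offset n w.2 y) in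
  all (fun t =>
    let ys := filter (col (t, 0)) (iota 0 n) in
    all (fun v =>
      let zs := filter (col v) ys in
      all (fun w => has (col w) zs) V) V) [:: true; false].

Lemma all_collide_checkP n : 2 <= n -> all_collide_check n -> all_collide n.
Proof.
move=> n2 chk [|a [|b [|d []]]] //= _ Wn.
have [an bn dn] : [/\ a.2 < n, b.2 < n & d.2 < n].
  by split; apply: Wn; rewrite !inE eqxx ?orbT.
apply: (@collision_rotate n (n - a.2)) => //; first exact: leq_subr.
rewrite /= (_ : shift n (n - a.2) a.2 = 0); last by rewrite /shift; case: ifP; lia.
have inV (v : bool * nat) : v.2 < n ->
    (v.1, shift n (n - a.2) v.2) \in [seq (t, x) | t <- [:: true; false], x <- iota 0 n].
  move=> vn; apply: allpairs_f; first by case: v.1.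
  by rewrite mem_iota shift_lt ?leq_subr //; lia.
have a1 : a.1 \in [:: true; false] by case: a.1.
move/allP/(_ _ a1)/allP/(_ _ (inV b bn))/allP/(_ _ (inV d dn)): chk.
case/hasP => y; rewrite !mem_filter mem_iota => /and3P[yb ya yn].
have colE (w : bool * nat) : w.2 < n -> nth false (if w.1 then collide_table n true
    else collide_table n false) (offset n w.2 y) = collide_test n w y.
  by case: w => -[] x xn; rewrite -nth_collide_table.
have n0 : 0 < n by lia.
move: ya yb; rewrite (colE (_, 0)) // !colE ?shift_lt ?leq_subr // => ya yb yd.
by exists y => // w; rewrite !inE => /or3P[] /eqP ->; apply/eqP.
Qed.

Lemma all_collide_small k : 6 <= k <= 8 -> all_collide (6 * k + 2).
Proof.
move=> k68; apply: all_collide_checkP; first by lia.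
have {k68} : k \in [:: 6; 7; 8] by rewrite !inE; lia.
by rewrite !inE => /or3P[] /eqP ->; vm_compute.
Qed.

(** * Conclusion for all lengths 6k+2 *)

Lemma all_collide_6k2 k : 6 <= k -> all_collide (6 * k + 2).
Proof.
elim: k => // k IHk k6; have [k8|k8] := ltnP k 8; first by apply: all_collide_small; lia.
have -> : 6 * k.+1 + 2 = (3 * k + 1).*2 + 6 by lia.
(* Half the shorter length is [3 * k + 1], which is at least 25 exactly when [k >= 8]; this is why
   6, 7 and 8 are the base cases. *)
apply: all_collide_insert3; first by lia.
by rewrite (_ : (3 * k + 1).*2 = 6 * k + 2); [apply: IHk; lia | lia].
Qed.

Theorem theorem4 (n k : nat) (hk : 6 <= k) (hn : n = 6 * k + 2) :
  4 <= metric_dim (@gpetersen n 3).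
Proof.
have n38 : 38 <= n by lia.
have n0 : 0 < n by lia.
rewrite /metric_dim; case: ex_minnP => m /existsP[W /andP[_ /injectiveP Winj]] _.
rewrite leqNgt; apply/negP => m4.
(* [all_collide] asks for exactly three landmarks and allows repetition. A pair that the padded
   sequence does not resolve is not resolved by [W] either. *)
pose pad := W ++ nseq (3 - m) (inl (Ordinal n0)).
have [||y yn coll] := @all_collide_6k2 k hk (map (@coords n) pad).
- by rewrite size_map size_cat size_nseq size_tuple; lia.
- by move=> _ /mapP[z _ ->]; rewrite -hn coords_lt.
rewrite -hn in yn coll.
have y2n : shift n 2 y < n by apply: shift_lt; lia.
have /Winj : metric_code (@gpetersen n 3) W (@vertex n (true, y) yn) =
    metric_code (@gpetersen n 3) W (@vertex n (true, shift n 2 y) y2n).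
  apply/eq_in_map => w wW; rewrite !gpetersen_dist ?vertexK; [|lia..].
  rewrite vdist_sym ?coords_lt // [RHS]vdist_sym ?coords_lt //.
  by apply: coll; rewrite map_f // mem_cat wW.
move/(congr1 (@coords n)); rewrite !vertexK => -[].
by rewrite /shift; case: ifP; lia.
Qed.
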